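(* Let $Q_k\in\mathbb{R}^{n\times n}$ and $R_k\in\mathbb{R}^{m(k)\times m(k)}$ ($k=1,\dots,N$) be symmetric positive definite matrices, let $G_k\in\mathbb{R}^{n\times n}$ ($k=2,\dots,N$), $H_k\in\mathbb{R}^{m(k)\times n}$, $z_k\in\mathbb{R}^{m(k)}$ ($k=1,\dots,N$) and $g_0\in\mathbb{R}^n$. Let $G,H,Q,R,z,w$ be the stacked data defined in the context, and consider the block tridiagonal linear system $$(H^\top R^{-1}H+G^\top Q^{-1}G)\,x=H^\top R^{-1}z+G^\top Q^{-1}w$$ for $x\in\mathbb{R}^{nN}$, which characterizes the minimizer of $\frac12(Hx-z)^\top R^{-1}(Hx-z)+\frac12(Gx-w)^\top Q^{-1}(Gx-w)$. Then the block tridiagonal algorithm applied to this system is equivalent to the Kalman filter followed by the Rauch-Tung-Striebel (RTS) smoother, in the following sense. Let $d_k,s_k,e_k$ be the quantities computed by the block tridiagonal algorithm, and let $x_{k|k},P_{k|k}$ and $x_{k|N}$ be the Kalman filter and RTS smoother quantities, all as defined in the context. Then: 1. $d_k=P_{k|k}^{-1}+G_{k+1}^\top Q_{k+1}^{-1}G_{k+1}$ for $k=1,\dots,N-1$, and $d_N=P_{N|N}^{-1}$; 2. $s_k=P_{k|k}^{-1}x_{k|k}$ for $k=1,\dots,N$; 3. $e_N=x_{N|N}$; 4. $e_k=x_{k|N}$ for $k=1,\dots,N$.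
   Context: Stacked data. $H=\mathrm{diag}(H_1,\dots,H_N)$, $Q=\mathrm{diag}(Q_1,\dots,Q_N)$, $R=\mathrm{diag}(R_1,\dots,R_N)$ are block diagonal; $z$ is the vector obtained by stacking $z_1,\dots,z_N$; $w\in\mathbb{R}^{nN}$ is obtained by stacking $g_0,0,\dots,0$; $G\in\mathbb{R}^{nN\times nN}$ is block lower bidiagonal with identity diagonal blocks, with block $-G_k$ in position $(k,k-1)$ for $k=2,\dots,N$, and zero elsewhere. These data correspond to the linear Gaussian model $x_1=g_0+w_1$, $x_k=G_kx_{k-1}+w_k$ ($k\ge2$), $z_k=H_kx_k+v_k$ ($k\geq 1$), with mutually independent $w_k\sim N(0,Q_k)$, $v_k\sim N(0,R_k)$. Block tridiagonal algorithm. Write the system matrix with diagonal blocks $c_k\in\mathbb{R}^{n\times n}$ ($k=1,\dots,N$), blocks $a_k$ in position $(k,k-1)$ and $a_k^\top$ in position $(k-1,k)$ ($k=2,\dots,N$), and zero blocks elsewhere, and write the right-hand side as the stacked vector of $r_1,\dots,r_N\in\mathbb{R}^n$. Explicitly, $a_k=-Q_k^{-1}G_k$ and $c_k=Q_k^{-1}+G_{k+1}^\top Q_{k+1}^{-1}G_{k+1}+H_k^\top R_k^{-1}H_k$, where the term with index $k+1$ is omitted for $k=N$. The algorithm computes: (i) $d_1=c_1$, $s_1=r_1$; (ii) for $k=2,\dots,N$: $d_k=c_k-a_kd_{k-1}^{-1}a_k^\top$ and $s_k=r_k-a_kd_{k-1}^{-1}s_{k-1}$; (iii) $e_N=d_N^{-1}s_N$;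 (iv) for $k=N-1,\dots,1$: $e_k=d_k^{-1}(s_k-a_{k+1}^\top e_{k+1})$. The output $(e_1,\dots,e_N)$ is the solution $x$ of the system. Kalman filter. Set $x_{1|0}=g_0$, $P_{1|0}=Q_1$. For $k=1,\dots,N$: $P_{k|k}=(P_{k|k-1}^{-1}+H_k^\top R_k^{-1}H_k)^{-1}$ and $x_{k|k}=P_{k|k}(P_{k|k-1}^{-1}x_{k|k-1}+H_k^\top R_k^{-1}z_k)$. For $k=1,\dots,N-1$: $x_{k+1|k}=G_{k+1}x_{k|k}$ and $P_{k+1|k}=G_{k+1}P_{k|k}G_{k+1}^\top+Q_{k+1}$. Here $x_{k|j}$ and $P_{k|j}$ are the estimate and covariance of the state at time $k$ given $z_1,\dots,z_j$. RTS smoother. $x_{N|N}$ is the final filter estimate, and for $k=N-1,\dots,1$: $x_{k|N}=x_{k|k}+P_{k|k}G_{k+1}^\top P_{k+1|k}^{-1}(x_{k+1|N}-x_{k+1|k})$. *)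

(* Defs.v *)
From HB Require Import structures.
From mathcomp Require Import all_boot all_order all_algebra.
From mathcomp Require Import reals.

Set Implicit Arguments.
Unset Strict Implicit.
Unset Printing Implicit Defensive.

Import Order.TTheory GRing.Theory Num.Theory.
Local Open Scope ring_scope.

(* Time-indexed data are functions on [nat] used at the indices 1, ..., N only;
   the ordinal i : 'I_N stands for the time i.+1. *)

Definition sym_posdef (K : realType) (p : nat) (A : 'M[K]_p) : Prop :=
  A^T = A /\ forall x : 'cV[K]_p, x != 0 -> 0 < (x^T *m A *m x) 0 0.

Section StackedData.
Context (K : realType) (N n : nat) (m : nat -> nat).
Context (Q G : nat -> 'M[K]_n) (R : forall k, 'M[K]_(m k)).
Context (H : forall k, 'M[K]_(m k, n)) (z : forall k, 'cV[K]_(m k)).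
Context (g0 : 'cV[K]_n).

(* [\mxdiag] only covers square diagonal blocks, hence [\mxblock]. *)
Definition stackH : 'M[K]_(\sum_(i < N) m i.+1, \sum_(i < N) n) :=
  \mxblock_(i < N, j < N) (if i == j then H i.+1 else 0).

Definition stackQ : 'M[K]_(\sum_(i < N) n) := \mxdiag_(i < N) Q i.+1.

Definition stackR : 'M[K]_(\sum_(i < N) m i.+1) := \mxdiag_(i < N) R i.+1.

Definition stackG : 'M[K]_(\sum_(i < N) n) :=
  \mxblock_(i < N, j < N)
    (if i == j then 1%:M else if i == j.+1 :> nat then - G i.+1 else 0).

Definition stackz : 'cV[K]_(\sum_(i < N) m i.+1) := \mxcol_(i < N) z i.+1.

Definition stackw : 'cV[K]_(\sum_(i < N) n) :=
  \mxcol_(i < N) (if i == 0%N :> nat then g0 else 0).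

Definition sysmx : 'M[K]_(\sum_(i < N) n) :=
  stackH^T *m invmx stackR *m stackH + stackG^T *m invmx stackQ *m stackG.

Definition sysrhs : 'cV[K]_(\sum_(i < N) n) :=
  stackH^T *m invmx stackR *m stackz + stackG^T *m invmx stackQ *m stackw.

Definition objective (x : 'cV[K]_(\sum_(i < N) n)) : K :=
  2^-1 * ((stackH *m x - stackz)^T *m invmx stackR *m (stackH *m x - stackz)) 0 0
  + 2^-1 * ((stackG *m x - stackw)^T *m invmx stackQ *m (stackG *m x - stackw)) 0 0.

End StackedData.

(* Blocks of a stacked matrix or vector, numbered from 1 to N. *)
Definition mxblk (K : realType) (N n : nat) (A : 'M[K]_(\sum_(i < N) n))
    (k l : nat) : 'M[K]_n :=
  match insub k.-1 : option 'I_N, insub l.-1 : option 'I_N with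
  | Some i, Some j =>
      submxblock (p_ := fun _ : 'I_N => n) (q_ := fun _ : 'I_N => n) A i j
  | _, _ => 0
  end.

Definition cvblk (K : realType) (N n : nat) (b : 'cV[K]_(\sum_(i < N) n))
    (k : nat) : 'cV[K]_n :=
  if (insub k.-1 : option 'I_N) is Some i
  then submxcol (p_ := fun _ : 'I_N => n) b i else 0.

(* The block tridiagonal algorithm for diagonal blocks c_1, ..., c_N,
   subdiagonal blocks a_2, ..., a_N and right-hand side r_1, ..., r_N. *)
Section BlockTridiagonal.
Context (K : realType) (N n : nat).
Context (c a : nat -> 'M[K]_n) (r : nat -> 'cV[K]_n).

Fixpoint bt_d (k : nat) : 'M[K]_n :=
  match k with
  | 0 => 0
  | j.+1 => match j with
            | 0 => c 1
            | _.+1 => c j.+1 - a j.+1 *m invmx (bt_d j) *m (a j.+1)^T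
            end
  end.

Fixpoint bt_s (k : nat) : 'cV[K]_n :=
  match k with
  | 0 => 0
  | j.+1 => match j with
            | 0 => r 1
            | _.+1 => r j.+1 - a j.+1 *m invmx (bt_d j) *m bt_s j
            end
  end.

(* [iota k (N - k)] lists k, ..., N - 1, so the fold runs down from N to k;
   see [bt_eN] and [bt_eS]. *)
Definition bt_e (k : nat) : 'cV[K]_n :=
  foldr (fun j e => invmx (bt_d j) *m (bt_s j - (a j.+1)^T *m e))
        (invmx (bt_d N) *m bt_s N) (iota k (N - k)).

Lemma bt_d1 : bt_d 1 = c 1. Proof. by []. Qed.

Lemma bt_s1 : bt_s 1 = r 1. Proof. by []. Qed.

Lemma bt_dS (k : nat) : (0 < k)%N ->
  bt_d k.+1 = c k.+1 - a k.+1 *m invmx (bt_d k) *m (a k.+1)^T.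
Proof. by case: k. Qed.

Lemma bt_sS (k : nat) : (0 < k)%N ->
  bt_s k.+1 = r k.+1 - a k.+1 *m invmx (bt_d k) *m bt_s k.
Proof. by case: k. Qed.

Lemma bt_eN : bt_e N = invmx (bt_d N) *m bt_s N.
Proof. by rewrite /bt_e subnn. Qed.

Lemma bt_eS (k : nat) : (k < N)%N ->
  bt_e k = invmx (bt_d k) *m (bt_s k - (a k.+1)^T *m bt_e k.+1).
Proof. by move=> kN; rewrite /bt_e -(subnSK kN). Qed.

End BlockTridiagonal.

Section KalmanRTS.
Context (K : realType) (N n : nat) (m : nat -> nat).
Context (Q G : nat -> 'M[K]_n) (R : forall k, 'M[K]_(m k)).
Context (H : forall k, 'M[K]_(m k, n)) (z : forall k, 'cV[K]_(m k)).
Context (g0 : 'cV[K]_n).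

(* Measurement update at time k of a predicted covariance P and state x. *)
Definition kf_updP (k : nat) (P : 'M[K]_n) : 'M[K]_n :=
  invmx (invmx P + (H k)^T *m invmx (R k) *m H k).

Definition kf_updx (k : nat) (P : 'M[K]_n) (x : 'cV[K]_n) : 'cV[K]_n :=
  kf_updP k P *m (invmx P *m x + (H k)^T *m invmx (R k) *m z k).

(* P_{k|k-1} *)
Fixpoint kf_Ppred (k : nat) : 'M[K]_n :=
  match k with
  | 0 => 0
  | j.+1 => match j with
            | 0 => Q 1
            | _.+1 => G j.+1 *m kf_updP j (kf_Ppred j) *m (G j.+1)^T + Q j.+1
            end
  end.

(* x_{k|k-1} *)
Fixpoint kf_xpred (k : nat) : 'cV[K]_n :=
  match k with
  | 0 => 0
  | j.+1 => match j with
            | 0 => g0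
            | _.+1 => G j.+1 *m kf_updx j (kf_Ppred j) (kf_xpred j)
            end
  end.

(* P_{k|k} *)
Definition kf_P (k : nat) : 'M[K]_n := kf_updP k (kf_Ppred k).

(* x_{k|k} *)
Definition kf_x (k : nat) : 'cV[K]_n := kf_updx k (kf_Ppred k) (kf_xpred k).

(* x_{k|N}, by a fold running down from N to k; see [rts_xN] and [rts_xS]. *)
Definition rts_x (k : nat) : 'cV[K]_n :=
  foldr (fun j x => kf_x j + kf_P j *m (G j.+1)^T *m invmx (kf_Ppred j.+1)
                             *m (x - kf_xpred j.+1))
        (kf_x N) (iota k (N - k)).

Lemma kf_PpredS (k : nat) : (0 < k)%N ->
  kf_Ppred k.+1 = G k.+1 *m kf_P k *m (G k.+1)^T + Q k.+1.
Proof. by case: k. Qed.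

Lemma kf_xpredS (k : nat) : (0 < k)%N -> kf_xpred k.+1 = G k.+1 *m kf_x k.
Proof. by case: k. Qed.

Lemma kf_PE (k : nat) :
  kf_P k = invmx (invmx (kf_Ppred k) + (H k)^T *m invmx (R k) *m H k).
Proof. by []. Qed.

Lemma kf_xE (k : nat) :
  kf_x k = kf_P k *m (invmx (kf_Ppred k) *m kf_xpred k
                      + (H k)^T *m invmx (R k) *m z k).
Proof. by []. Qed.

Lemma rts_xN : rts_x N = kf_x N.
Proof. by rewrite /rts_x subnn. Qed.

Lemma rts_xS (k : nat) : (k < N)%N ->
  rts_x k = kf_x k + kf_P k *m (G k.+1)^T *m invmx (kf_Ppred k.+1)
                     *m (rts_x k.+1 - kf_xpred k.+1).
Proof. by move=> kN; rewrite /rts_x -(subnSK kN). Qed.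

End KalmanRTS.

(* Main.v *)
(** With P = P_{k|k} and S = P_{k+1|k}, the elimination step is carried through
    the identities
      Q^-1 - Q^-1 G D^-1 G^T Q^-1 = S^-1   and   Q^-1 G D^-1 = S^-1 G P,
    where D = P^-1 + G^T Q^-1 G and S = G P G^T + Q.  By induction on the time
    they turn the recursion for d_k into the information form of the covariance
    update, and the recursion for s_k into that of the state update.  The
    transposed identity D^-1 G^T Q^-1 = P G^T S^-1 shows that back substitution
    uses the RTS gain.  Elimination with invertible pivots solves the block
    tridiagonal system uniquely, and a system with positive semidefinite
    symmetric matrix characterizes the minimizers of its quadratic form. *)

Require Import Defs.
From HB Require Import structures.
From mathcomp Require Import all_boot all_order all_algebra.
From mathcomp Require Import reals.
From mathcomp Require Import ring lra.

Set Implicit Arguments.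
Unset Strict Implicit.
Unset Printing Implicit Defensive.

Import Order.TTheory GRing.Theory Num.Theory.
Local Open Scope ring_scope.

(** * Positive definite and semidefinite matrices *)

Definition sym_psd (K : realType) (p : nat) (A : 'M[K]_p) : Prop :=
  A^T = A /\ forall x : 'cV[K]_p, 0 <= (x^T *m A *m x) 0 0.

Section PosDef.
Context (K : realType).

Lemma sym_posdef_psd p (A : 'M[K]_p) : sym_posdef A -> sym_psd A.
Proof.
move=> [symA posA]; split=> // x; have [->|x0] := eqVneq x 0.
  by rewrite mulmx0 mxE.
exact/ltW/posA.
Qed.

Lemma sym_posdefD p (A B : 'M[K]_p) :
  sym_posdef A -> sym_psd B -> sym_posdef (A + B).
Proof.
move=> [symA posA] [symB psdB]; split; first by rewrite linearD /= symA symB.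
by move=> x x0; rewrite mulmxDr mulmxDl mxE ltr_wpDr ?posA.
Qed.

Lemma sym_psdD p (A B : 'M[K]_p) : sym_psd A -> sym_psd B -> sym_psd (A + B).
Proof.
move=> [symA psdA] [symB psdB]; split; first by rewrite linearD /= symA symB.
by move=> x; rewrite mulmxDr mulmxDl mxE addr_ge0.
Qed.

Lemma sym_psd_congr p q (A : 'M[K]_p) (M : 'M[K]_(p, q)) :
  sym_psd A -> sym_psd (M^T *m A *m M).
Proof.
move=> [symA psdA]; split; first by rewrite !trmx_mul trmxK symA mulmxA.
by move=> x; have := psdA (M *m x); rewrite trmx_mul !mulmxA.
Qed.

Lemma sym_posdef_unit p (A : 'M[K]_p) : sym_posdef A -> A \in unitmx.
Proof.
move=> [symA posA]; rewrite unitmxE unitfE; apply/negP => /det0P[v v0 vA].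
have vT0 : v^T != 0 by rewrite -trmx0 (inj_eq trmx_inj).
by have := posA _ vT0; rewrite trmxK vA mul0mx mxE ltxx.
Qed.

Lemma sym_posdef_inv p (A : 'M[K]_p) : sym_posdef A -> sym_posdef (invmx A).
Proof.
move=> pdA; have uA := sym_posdef_unit pdA; have [symA posA] := pdA.
have symV : (invmx A)^T = invmx A by rewrite trmx_inv symA.
split=> // x x0.
have Vx0 : invmx A *m x != 0.
  by apply: contra_neq x0 => Vx; rewrite -(mulKVmx uA x) Vx mulmx0.
by have := posA _ Vx0; rewrite trmx_mul symV -!mulmxA (mulKVmx uA).
Qed.

Lemma invmx_mxdiag N (p_ : 'I_N -> nat) (D : forall i, 'M[K]_(p_ i)) :
  (forall i, D i \in unitmx) ->
  invmx (\mxdiag_i D i) = \mxdiag_i invmx (D i).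
Proof.
move=> uD; have DV : \mxdiag_i D i *m \mxdiag_i invmx (D i) = 1%:M.
  rewrite [X in _ *m X]/mxdiag mul_mxdiag_mxblock -mxdiagZ.
  apply/eq_mxblockP => i j; have [<-|_] := eqVneq i j.
    (* The diagonal blocks of [\mxdiag] are typed through [conform_mx], which is the identity once
       the two indices coincide. *)
    by rewrite !conform_mx_id mulmxV.
  by rewrite mulmx0.
have [uD' _] := mulmx1_unit DV.
by rewrite -[RHS](mulKmx uD') DV mulmx1.
Qed.

(** The form splits into the sum of the forms of the blocks. A nonzero vector has a nonzero block,
    whose term is positive while the others are nonnegative. *)
Lemma sym_posdef_mxdiag N (p_ : 'I_N -> nat) (D : forall i, 'M[K]_(p_ i)) :
  (forall i, sym_posdef (D i)) -> sym_posdef (\mxdiag_i D i).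
Proof.
move=> pdD; split; first by rewrite tr_mxdiag; apply: eq_mxdiag => i; case: (pdD i).
move=> x; rewrite -[x]submxcolK => x0.
rewrite -mulmxA mul_mxdiag_mxcol tr_mxcol mul_mxrow_mxcol summxE.
have /existsP[i xi0] : [exists i, submxcol x i != 0].
  apply: contraNT x0 => /existsPn x0; rewrite -[0](@mxcol0 _ _ p_).
  by apply/eqP/eq_mxcol => i; apply/eqP; rewrite -[_ == _]negbK x0.
rewrite (bigD1 i) //= ltr_pwDl //; first by rewrite mulmxA; apply: (pdD i).2.
by apply: sumr_ge0 => j _; rewrite mulmxA; apply: (sym_posdef_psd (pdD j)).2.
Qed.

End PosDef.

(** * Minimizers of quadratic functions and the normal equations *)

Section LeastSquares.
Context (K : realType).

Lemma mx00D (A B : 'M[K]_1) : (A + B) 0 0 = A 0 0 + B 0 0.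
Proof. exact: mxE. Qed.

Lemma mx00N (A : 'M[K]_1) : (- A) 0 0 = - A 0 0.
Proof. exact: mxE. Qed.

(** The expansion [fD] around [y] is exact. If the gradient [A *m y - b] vanishes, only a
    nonnegative term remains; otherwise a suitable step along the gradient would decrease [f]. *)
Lemma sym_psd_quad_min p (A : 'M[K]_p) (b : 'cV[K]_p) (f0 : K)
    (f : 'cV[K]_p -> K) (y : 'cV[K]_p) : sym_psd A ->
  (forall v, f v = 2^-1 * (v^T *m A *m v) 0 0 - (v^T *m b) 0 0 + f0) ->
  A *m y = b <-> forall y', f y <= f y'.
Proof.
move=> [symA psdA] fE.
have fD (h : 'cV[K]_p) :
    f (y + h) = f y + (h^T *m (A *m y - b)) 0 0 + 2^-1 * (h^T *m A *m h) 0 0.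
  have symyh : (y^T *m A *m h) 0 0 = (h^T *m A *m y) 0 0.
    (* A 1 x 1 matrix equals its transpose. *)
    by rewrite -[y^T *m A *m h]trmxK [LHS]mxE !trmx_mul trmxK symA mulmxA.
  rewrite !fE [(y + h)^T]linearD /= !(mulmxDl, mulmxDr) mulmxN !mulmxA.
  rewrite !(mx00D, mx00N) symyh.
  by field.
split=> [Ay|miny].
  move=> y'; rewrite -(subrK y y') addrC fD Ay subrr mulmx0 mxE addr0.
  by rewrite lerDl mulr_ge0 ?invr_ge0 ?ler0n.
apply/eqP; rewrite -subr_eq0; set h := A *m y - b.
have hh : (h^T *m h) 0 0 = \sum_i h i 0 ^+ 2.
  by rewrite mxE; apply: eq_bigr => i _; rewrite mxE expr2.
set q := (h^T *m A *m h) 0 0.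
have ft (t : K) : 0 <= t * (h^T *m h) 0 0 + 2^-1 * t ^+ 2 * q.
  have := miny (y + t *: h); rewrite fD -addrA lerDl linearZ /=.
  rewrite -!scalemxAl -scalemxAr -/h.
  by rewrite 3!mxE [X in _ * (_ * X)]mxE -/q expr2 !mulrA.
have q0 : 0 <= q by apply: psdA.
have hh0 : (h^T *m h) 0 0 = 0.
  apply/eqP; rewrite eq_le; apply/andP; split; last first.
    by rewrite hh sumr_ge0 // => i _; rewrite sqr_ge0.
  set u := (h^T *m h) 0 0 in ft *.
  (* A step of this length against the gradient h decreases f unless h = 0. *)
  have := ft (- (u / (1 + q))).
  have w0 : 0 < 1 + q by rewrite ltr_pwDl.
  move=> /(mulr_ge0 (ltW w0)).
  (* Dividing by [1 + q] stays legitimate when [q = 0]. Since q / (1 + q) is at most 1, the last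
     factor is at least 1/2. *)
  have -> : (1 + q) *
      (- (u / (1 + q)) * u + 2^-1 * (- (u / (1 + q))) ^+ 2 * q)
    = - u ^+ 2 * (1 - 2^-1 * (q / (1 + q))).
    by field; rewrite gt_eqF.
  have q1 : q / (1 + q) <= 1 by rewrite ler_pdivrMr // mul1r; lra.
  rewrite mulNr oppr_ge0 leNgt => /negP ineq; rewrite leNgt; apply/negP => u0.
  by apply: ineq; apply: mulr_gt0; [rewrite exprn_gt0 | lra].
apply/eqP/colP => i; rewrite [RHS]mxE; apply/eqP; rewrite -sqrf_eq0.
move: hh0; rewrite hh => /eqP; rewrite psumr_eq0 => [|j _].
  by move=> /allP /(_ i (mem_index_enum _)).
by rewrite sqr_ge0.
Qed.

(** Brings a weighted residual into the shape required by [sym_psd_quad_min]; symmetry of [W] merges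
    the two cross terms. *)
Lemma weighted_residualE p q (M : 'M[K]_(p, q)) (W : 'M[K]_p) (v : 'cV[K]_p)
    (y : 'cV[K]_q) : W^T = W ->
  2^-1 * ((M *m y - v)^T *m W *m (M *m y - v)) 0 0 =
  2^-1 * (y^T *m (M^T *m W *m M) *m y) 0 0 - (y^T *m (M^T *m W *m v)) 0 0
  + 2^-1 * (v^T *m W *m v) 0 0.
Proof.
move=> symW.
have symvy : (v^T *m W *m M *m y) 0 0 = (y^T *m M^T *m W *m v) 0 0.
  by rewrite -[v^T *m W *m M *m y]trmxK [LHS]mxE !trmx_mul trmxK symW !mulmxA.
rewrite [(_ - _)^T]linearB /= trmx_mul !(mulmxDl, mulmxDr, mulmxN, mulNmx) !mulmxA.
by rewrite !(mx00D, mx00N) symvy; field.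
Qed.

End LeastSquares.

(** * Correctness of block elimination and back substitution *)

Section BlockTridiagonalSolve.
Context (K : realType) (N n : nat).
Context (c a : nat -> 'M[K]_n) (r : nat -> 'cV[K]_n).

(** Subtracting [a k.+1 *m invmx (bt_d c a k)] times the reduced row k from row k+1 is reversible.
    The superdiagonal term is abstracted as [u], prescribed only for k < N, so that it can be taken
    to be 0 in the last row. *)
Lemma bt_forwardP (y u : nat -> 'cV[K]_n) :
  (forall k, (1 <= k <= N)%N -> bt_d c a k \in unitmx) ->
  (forall k, (1 <= k < N)%N -> u k = (a k.+1)^T *m y k.+1) ->
  (forall k, (1 <= k <= N)%N ->
     (if (1 < k)%N then a k *m y k.-1 else 0) + c k *m y k + u k = r k) <->
  (forall k, (1 <= k <= N)%N -> bt_d c a k *m y k + u k = bt_s c a r k).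
Proof.
move=> ud uE.
have step k : (0 < k < N)%N -> bt_d c a k *m y k + u k = bt_s c a r k ->
    (a k.+1 *m y k + c k.+1 *m y k.+1 + u k.+1 = r k.+1 <->
     bt_d c a k.+1 *m y k.+1 + u k.+1 = bt_s c a r k.+1).
  move=> /andP[k0 kN] fk; rewrite bt_dS // bt_sS // -fk (uE k) ?k0 //.
  rewrite mulmxBl mulmxDr -!mulmxA mulKmx ?ud ?k0 1?ltnW //.
  (* With [bt_s c a r k] expanded by the reduced row k, the correction [M] occurs on both sides of
     the reduced row k+1 and cancels. *)
  set X := a _ *m y k; set Y := c _ *m _; set M := a _ *m (_ *m _).
  have reorder : X + Y + u k.+1 = Y - M + u k.+1 + (X + M).
    by rewrite [X + M]addrC !addrA [Y - M + _]addrAC subrK -[LHS]addrA [LHS]addrC.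
  by rewrite reorder; split=> [<-|->]; rewrite ?addrK ?subrK.
split=> eqs; elim=> [//|[|k] IHk] kN.
- by have := eqs 1%N kN; rewrite add0r.
- by apply/(step k.+1 kN (IHk (ltnW kN))); apply: (eqs k.+2 kN).
- by have := eqs 1%N kN; rewrite /= add0r.
- by apply/(step k.+1 kN (eqs k.+1 (ltnW kN))); apply: (eqs k.+2 kN).
Qed.

Lemma bt_backwardP (y : nat -> 'cV[K]_n) :
  (forall k, (1 <= k <= N)%N -> bt_d c a k \in unitmx) ->
  (forall k, (1 <= k <= N)%N ->
     bt_d c a k *m y k + (if (k < N)%N then (a k.+1)^T *m y k.+1 else 0)
     = bt_s c a r k) <->
  (forall k, (1 <= k <= N)%N -> y k = bt_e N c a r k).
Proof.
move=> ud; split=> eqs k /andP[k0 kN].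
  (* Descending induction on k, run as an induction on N - k. *)
  have [j Ej] : exists j, j = (N - k)%N by eexists.
  elim: j k k0 kN Ej => [|j IHj] k k0 kN Ej.
    have kE : k = N by apply/eqP; rewrite eqn_leq kN /= -subn_eq0 -Ej.
    have := eqs k; rewrite k0 kN => /(_ isT).
    rewrite kE ltnn addr0 bt_eN => <-.
    by rewrite mulKmx // ud // -{1}kE k0 /=.
  have kN' : (k < N)%N by rewrite -subn_gt0 -Ej.
  rewrite bt_eS // -(IHj k.+1) // ?subnS -?Ej //.
  have := eqs k; rewrite k0 kN kN' => /(_ isT) <-.
  by rewrite addrK mulKmx // ud // k0.
rewrite eqs ?k0 //; have [kN'|] := ltnP k N.
  by rewrite bt_eS // mulKVmx ?ud ?k0 // eqs ?subrK.
move=> Nk; have -> : k = N by apply/eqP; rewrite eqn_leq kN.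
by rewrite bt_eN mulKVmx ?addr0 // ud // leqnn andbT (leq_trans k0).
Qed.

Lemma bt_solveP (y : nat -> 'cV[K]_n) :
  (forall k, (1 <= k <= N)%N -> bt_d c a k \in unitmx) ->
  (forall k, (1 <= k <= N)%N ->
     (if (1 < k)%N then a k *m y k.-1 else 0) + c k *m y k
     + (if (k < N)%N then (a k.+1)^T *m y k.+1 else 0) = r k) <->
  (forall k, (1 <= k <= N)%N -> y k = bt_e N c a r k).
Proof.
move=> ud; apply: iff_trans (bt_backwardP y ud).
by apply: bt_forwardP => // k /andP[_ ->].
Qed.

End BlockTridiagonalSolve.

(** * Matrix identities for one Kalman step *)

Section Gain.
Context (K : realType) (n : nat) (P Q G : 'M[K]_n).
Hypotheses (uP : P \in unitmx) (uQ : Q \in unitmx).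
Local Notation S := (G *m P *m G^T + Q).
Local Notation D := (invmx P + G^T *m invmx Q *m G).
Hypotheses (uS : S \in unitmx) (uD : D \in unitmx).

(** Both S Q^-1 G and G P D expand to G + G P G^T Q^-1 G; cancel S on the left and D on the
    right. *)
Lemma info_gainE : invmx Q *m G *m invmx D = invmx S *m G *m P.
Proof.
have SG : S *m (invmx Q *m G) = G *m P *m D.
  rewrite mulmxDl mulmxDr mulKVmx // -[G *m P *m invmx P]mulmxA mulmxV //.
  by rewrite mulmx1 addrC !mulmxA.
by rewrite -[LHS](mulKmx uS) [S *m _]mulmxA SG mulmxK // mulmxA.
Qed.

(** Mirror image of [info_gainE], from G^T Q^-1 S = D P G^T. It is derived directly because
    transposing would require symmetric P and Q. *)
Lemma cov_gainE : invmx D *m G^T *m invmx Q = P *m G^T *m invmx S.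
Proof.
have GS : G^T *m invmx Q *m S = D *m (P *m G^T).
  rewrite mulmxDl mulmxDr mulmxKV // mulKmx // addrC !mulmxA //.
rewrite -[LHS](mulmxK uS); congr (_ *m _).
by rewrite -2![LHS]mulmxA [X in _ *m X = _]mulmxA GS mulKmx.
Qed.

(** An instance of the Woodbury identity: by [info_gainE] the left side is S^-1 (S - G P G^T) Q^-1,
    and the bracket is Q. *)
Lemma invmx_innovationE :
  invmx Q - invmx Q *m G *m invmx D *m G^T *m invmx Q = invmx S.
Proof.
have SQ : S - G *m P *m G^T = Q by rewrite addrAC subrr add0r.
have EQ : (S - G *m P *m G^T) *m invmx Q = 1%:M by rewrite SQ mulmxV.
rewrite info_gainE -{1}(mulKmx uS (invmx Q)) -!mulmxA -mulmxBr.
by move: EQ; rewrite mulmxBl -!mulmxA => ->; rewrite mulmx1.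
Qed.

(** Gives the weight of the filtered state in back substitution: removing D^-1 G^T Q^-1 G from D^-1
    D = 1 leaves D^-1 P^-1. *)
Lemma smoother_gainE : invmx D *m invmx P = 1%:M - P *m G^T *m invmx S *m G.
Proof.
rewrite -cov_gainE -(mulVmx uD) -!mulmxA -mulmxBr !mulmxA.
by rewrite addrK.
Qed.

End Gain.

(** * Block extraction by selector matrices *)

Section BlockRows.
Context (K : realType) (N n : nat).

(* The rows of the identity matrix that select block k of a stacked vector; the
   zero matrix when k is outside 1, ..., N, so that boundary terms vanish. *)
Definition blkrow (k : nat) : 'M[K]_(n, \sum_(i < N) n) :=
  \mxrow_(j < N) (if j.+1 == k then 1%:M else 0).

Lemma sum_ord_eqS (V : zmodType) (F : nat -> V) (k : nat) :
  \sum_(i < N) (if i.+1 == k then F i.+1 else 0) =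
  if (1 <= k <= N)%N then F k else 0.
Proof.
rewrite -big_mkcond; case: k => [|k] /=; first by rewrite big_pred0.
have [kN|Nk] := ltnP k N; first by rewrite (big_pred1 (Ordinal kN)).
by rewrite big_pred0 // => i; apply: contraTF Nk => /eqP[<-]; rewrite -ltnNge.
Qed.

Lemma blkrow_mxcol p (F : nat -> 'M[K]_(n, p)) (k : nat) :
  blkrow k *m \mxcol_(i < N) F i.+1 = if (1 <= k <= N)%N then F k else 0.
Proof.
rewrite mul_mxrow_mxcol -sum_ord_eqS; apply: eq_bigr => i _.
by case: ifP; rewrite ?mul1mx ?mul0mx.
Qed.

Lemma blkrow_tr (k l : nat) : (1 <= k <= N)%N ->
  blkrow k *m (blkrow l)^T = if k == l then 1%:M else 0.
Proof.
move=> kN; rewrite [(blkrow l)^T]tr_mxrow.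
under eq_mxcol do rewrite (fun_if trmx) trmx1 trmx0.
by rewrite (blkrow_mxcol (fun i => if i == l then 1%:M else 0)) kN.
Qed.

Lemma ord_of_time (k : nat) : (1 <= k <= N)%N -> exists i : 'I_N, k = i.+1.
Proof. by case: k => [//|k] kN; exists (Ordinal kN). Qed.

(** Turns extraction into multiplication, so that blocks of products follow from associativity. *)
Lemma mxblkE (A : 'M[K]_(\sum_(i < N) n)) (k l : nat) :
  (1 <= k <= N)%N -> (1 <= l <= N)%N ->
  mxblk A k l = blkrow k *m A *m (blkrow l)^T.
Proof.
move=> /ord_of_time[i ->] /ord_of_time[j ->]; rewrite /mxblk /= !valK.
rewrite -[in RHS](submxblockK A) mul_mxrow_mxblock [(blkrow _)^T]tr_mxrow.
rewrite mul_mxrow_mxcol (big_only1 j) // => [|h hj _].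
  rewrite eqxx trmx1 mulmx1 (big_only1 i) // => [|h hi _].
    by rewrite eqxx mul1mx.
  by rewrite eqSS (inj_eq val_inj) (negPf hi) mul0mx.
by rewrite eqSS (inj_eq val_inj) (negPf hj) trmx0 mulmx0.
Qed.

Lemma cvblkE (b : 'cV[K]_(\sum_(i < N) n)) (k : nat) :
  (1 <= k <= N)%N -> cvblk b k = blkrow k *m b.
Proof.
move=> /ord_of_time[i ->]; rewrite /cvblk /= valK.
rewrite -[in RHS](submxcolK b) mul_mxrow_mxcol (big_only1 i) // => [|h hi _].
  by rewrite eqxx mul1mx.
by rewrite eqSS (inj_eq val_inj) (negPf hi) mul0mx.
Qed.

Lemma cvblk_mxcol (F : nat -> 'cV[K]_n) (k : nat) :
  (1 <= k <= N)%N -> cvblk (\mxcol_(i < N) F i.+1) k = F k.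
Proof. by move=> kN; rewrite cvblkE // blkrow_mxcol kN. Qed.

Lemma mxcol_cvblk (b : 'cV[K]_(\sum_(i < N) n)) :
  b = \mxcol_(i < N) cvblk b i.+1.
Proof.
by rewrite -[LHS]submxcolK; apply: eq_mxcol => i; rewrite /cvblk /= valK.
Qed.

Lemma cvblkP (b b' : 'cV[K]_(\sum_(i < N) n)) :
  (forall k, (1 <= k <= N)%N -> cvblk b k = cvblk b' k) <-> b = b'.
Proof.
split=> [bb'|-> //]; rewrite [b]mxcol_cvblk [b']mxcol_cvblk.
by apply: eq_mxcol => i; rewrite bb' //=.
Qed.

End BlockRows.

(** * Explicit blocks of the stacked system *)

Section StackedSystem.
Context (K : realType) (N n : nat) (m : nat -> nat).
Context (Q G : nat -> 'M[K]_n) (R : forall k, 'M[K]_(m k)).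
Context (H : forall k, 'M[K]_(m k, n)) (z : forall k, 'cV[K]_(m k)).
Context (g0 : 'cV[K]_n).

Lemma blkrow_out (k : nat) : ~~ (1 <= k <= N)%N -> blkrow K N n k = 0.
Proof.
move=> kN; apply/matrixP => i j; rewrite !mxE.
by case: eqP => [kE|_]; [case/negP: kN; rewrite -kE /= ltn_ord | rewrite mxE].
Qed.

(** For i = 0 the subtracted term vanishes because [blkrow] is zero at index 0, so the value [G 1]
    never enters. *)
Lemma stackG_mxcol :
  stackG N G =
  \mxcol_(i < N) (blkrow K N n i.+1 - G i.+1 *m blkrow K N n i).
Proof.
rewrite /stackG mxblockEv; apply: eq_mxcol => i.
rewrite mul_mxrow -mxrowB; apply: eq_mxrow => j.
rewrite eqSS -val_eqE /= eq_sym [_ == j.+1]eq_sym; case: eqP => [->|_].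
  by rewrite gtn_eqF // mulmx0 subr0.
by case: eqP => _; rewrite ?mulmx1 ?mulmx0 ?subr0 ?sub0r.
Qed.

Lemma stackG_tr_mxcol p (F : nat -> 'M[K]_(n, p)) :
  (stackG N G)^T *m \mxcol_(i < N) F i.+1 =
  \mxcol_(i < N)
    (F i.+1 - (if (i.+1 < N)%N then (G i.+2)^T *m F i.+2 else 0)).
Proof.
rewrite /stackG tr_mxblock mul_mxblock_mxrow; apply: eq_mxcol => i.
(* Both terms on the right are written back as sums over all blocks with at most one nonzero
   summand, and the sums are compared termwise. *)
have := @sum_ord_eqS N _ F i.+1; rewrite ltn_ord /= => <-.
have := @sum_ord_eqS N _ (fun k => (G k)^T *m F k) i.+2; rewrite /= => <-.
rewrite -sumrB; apply: eq_bigr => k _.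
rewrite !eqSS -val_eqE /=; have [->|_] := eqVneq (k : nat) i.
  by rewrite trmx1 mul1mx ltn_eqF // subr0.
by case: eqP => _; rewrite sub0r ?linearN ?mulNmx // trmx0 mul0mx oppr0.
Qed.

Lemma stackH_mxcol :
  stackH N H = \mxcol_(i < N) (H i.+1 *m blkrow K N n i.+1).
Proof.
rewrite /stackH mxblockEv; apply: eq_mxcol => i.
rewrite mul_mxrow; apply: eq_mxrow => j.
by rewrite eqSS -val_eqE eq_sym /=; case: eqP => _; rewrite ?mulmx1 ?mulmx0.
Qed.

Lemma stackH_tr_mxcol p (F : forall i : 'I_N, 'M[K]_(m i.+1, p)) :
  (stackH N H)^T *m \mxcol_(i < N) F i = \mxcol_(i < N) ((H i.+1)^T *m F i).
Proof.
rewrite /stackH tr_mxblock mul_mxblock_mxrow; apply: eq_mxcol => i.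
rewrite (big_only1 i) // => [|j ji _]; first by rewrite eqxx.
by rewrite (negPf ji) trmx0 mul0mx.
Qed.

Hypothesis Qpd : forall k, (1 <= k <= N)%N -> sym_posdef (Q k).
Hypothesis Rpd : forall k, (1 <= k <= N)%N -> sym_posdef (R k).

Definition sys_sub (k : nat) : 'M[K]_n := - (invmx (Q k) *m G k).

Definition sys_diag (k : nat) : 'M[K]_n :=
  invmx (Q k)
  + (if (k < N)%N then (G k.+1)^T *m invmx (Q k.+1) *m G k.+1 else 0)
  + (H k)^T *m invmx (R k) *m H k.

(** One formula serves every row: at k = 1 and k = N the outer [blkrow] has index 0 or N + 1 and is
    zero. *)
Definition sys_row (k : nat) : 'M[K]_(n, \sum_(i < N) n) :=
  sys_sub k *m blkrow K N n k.-1 + sys_diag k *m blkrow K N n k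
  + (sys_sub k.+1)^T *m blkrow K N n k.+1.

Definition sys_rhs (k : nat) : 'cV[K]_n :=
  (if k == 1%N then invmx (Q 1) *m g0 else 0) + (H k)^T *m invmx (R k) *m z k.

Lemma sys_sub_tr (k : nat) : sym_posdef (Q k) ->
  (sys_sub k)^T = - ((G k)^T *m invmx (Q k)).
Proof.
move=> pdQ; rewrite /sys_sub linearN /= trmx_mul.
by rewrite (sym_posdef_inv pdQ).1.
Qed.

Lemma invmx_stackQ : invmx (stackQ N Q) = \mxdiag_(i < N) invmx (Q i.+1).
Proof.
by apply: invmx_mxdiag => i; apply: sym_posdef_unit (@Qpd i.+1 (ltn_ord i)).
Qed.

Lemma invmx_stackR : invmx (stackR N R) = \mxdiag_(i < N) invmx (R i.+1).
Proof.
by apply: invmx_mxdiag => i; apply: sym_posdef_unit (@Rpd i.+1 (ltn_ord i)).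
Qed.

Lemma sysmx_mxcol : sysmx N Q G R H = \mxcol_(i < N) sys_row i.+1.
Proof.
(* [D k] is block row k of [stackG], see [stackG_mxcol]. *)
pose D k := blkrow K N n k - G k *m blkrow K N n k.-1.
have HRH : (stackH N H)^T *m (invmx (stackR N R) *m stackH N H) =
    \mxcol_(i < N) ((H i.+1)^T *m invmx (R i.+1) *m H i.+1 *m blkrow K N n i.+1).
  rewrite {2}stackH_mxcol invmx_stackR mul_mxdiag_mxcol stackH_tr_mxcol.
  by apply: eq_mxcol => i; rewrite !mulmxA.
have GQG : (stackG N G)^T *m (invmx (stackQ N Q) *m stackG N G) =
    \mxcol_(i < N) (invmx (Q i.+1) *m D i.+1
      - (if (i.+1 < N)%N then (G i.+2)^T *m (invmx (Q i.+2) *m D i.+2) else 0)).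
  rewrite {2}stackG_mxcol invmx_stackQ mul_mxdiag_mxcol.
  exact: (stackG_tr_mxcol (fun k => invmx (Q k) *m D k)).
rewrite /sysmx -!mulmxA HRH GQG -mxcolD; apply: eq_mxcol => i.
rewrite /sys_row /sys_diag /D /sys_sub /= mulmxBr mulNmx !mulmxDl.
(* The last row has no successor; its superdiagonal term has index N + 1 and vanishes. *)
case: ifP => [iN|/negP iN]; last first.
  rewrite (@blkrow_out i.+2) ?mulmx0 ?mul0mx; last exact/negP.
  by rewrite subr0 !addr0 mulmxA addrC addrA addrAC [RHS]addrC !addrA.
rewrite -/(sys_sub _) sys_sub_tr; last exact: Qpd.
rewrite mulNmx !mulmxBr opprB !mulmxA.
set x1 := _ *m blkrow _ _ _ i.+1; set x2 := _ *m blkrow _ _ _ i.+2.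
rewrite !addrA; congr (_ - x2).
by rewrite [RHS]addrC !addrA [x1 - _ + _]addrAC.
Qed.

Lemma sysrhs_mxcol : sysrhs N Q G R H z g0 = \mxcol_(i < N) sys_rhs i.+1.
Proof.
pose w k : 'cV[K]_n := if k == 1%N then g0 else 0.
rewrite /sysrhs invmx_stackQ invmx_stackR -!mulmxA !mul_mxdiag_mxcol.
rewrite stackH_tr_mxcol (stackG_tr_mxcol (fun k => invmx (Q k) *m w k)).
rewrite -mxcolD; apply: eq_mxcol => i.
(* The subtracted term sees [w] only at times at least 2, where it is zero. *)
rewrite /w /sys_rhs !mulmx0 if_same subr0 addrC mulmxA; congr (_ + _).
by case: ifP => [/eqP->|_]; rewrite ?mulmx0.
Qed.

Lemma mxblk_sysmx (k l : nat) : (1 <= k <= N)%N -> (1 <= l <= N)%N ->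
  mxblk (sysmx N Q G R H) k l =
  if k == l.+1 then sys_sub k else if k == l then sys_diag k
  else if k.+1 == l then (sys_sub l)^T else 0.
Proof.
move=> kN lN; rewrite mxblkE // sysmx_mxcol blkrow_mxcol kN 2!mulmxDl -!mulmxA.
(* The index i may be 0 or N + 1; both sides are then zero because [l] is in range. *)
have E i : blkrow K N n i *m (blkrow K N n l)^T = if i == l then 1%:M else 0.
  have [iN|iN] := boolP (1 <= i <= N)%N; first exact: blkrow_tr.
  by rewrite blkrow_out // mul0mx; case: eqP iN => // ->; rewrite lN.
rewrite !E; case: k kN => //= k kN; rewrite eqSS.
have [->|kl] := eqVneq k l.
  by rewrite !(gtn_eqF (leqnn _), gtn_eqF (leqnSn _)) mulmx1 !mulmx0 !addr0.
have [<-|k1l] := eqVneq k.+1 l.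
  by rewrite gtn_eqF // mulmx1 !mulmx0 addr0 add0r.
case: eqP => [<-|_]; last by rewrite !mulmx0 !addr0.
by rewrite mulmx1 !mulmx0 !add0r.
Qed.

Lemma cvblk_sysrhs (k : nat) : (1 <= k <= N)%N ->
  cvblk (sysrhs N Q G R H z g0) k = sys_rhs k.
Proof. by move=> kN; rewrite sysrhs_mxcol cvblk_mxcol. Qed.

Lemma cvblk_sysmx_mul (y : 'cV[K]_(\sum_(i < N) n)) (k : nat) :
  (1 <= k <= N)%N ->
  cvblk (sysmx N Q G R H *m y) k =
  (if (1 < k)%N then sys_sub k *m cvblk y k.-1 else 0) + sys_diag k *m cvblk y k
  + (if (k < N)%N then (sys_sub k.+1)^T *m cvblk y k.+1 else 0).
Proof.
move=> kN; rewrite cvblkE // mulmxA sysmx_mxcol blkrow_mxcol kN.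
rewrite 2!mulmxDl -!mulmxA -(cvblkE _ kN); have /andP[k0 kN'] := kN.
congr (_ + _ + _).
  have [k1|k1] := ltnP; last first.
    rewrite blkrow_out ?mul0mx ?mulmx0 //.
    by case: k k1 {kN k0 kN'} => [|[]].
  rewrite cvblkE //; case: k k1 kN' {kN k0} => // k /= k0 /ltnW ->.
  by rewrite -ltnS k0.
have [kN1|Nk] := ltnP k N; first by rewrite cvblkE //.
by rewrite blkrow_out ?mul0mx ?mulmx0 //= -leqNgt.
Qed.

Lemma sysmx_solveP (y : 'cV[K]_(\sum_(i < N) n)) :
  sysmx N Q G R H *m y = sysrhs N Q G R H z g0 <->
  (forall k, (1 <= k <= N)%N ->
     (if (1 < k)%N then sys_sub k *m cvblk y k.-1 else 0)
     + sys_diag k *m cvblk y k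
     + (if (k < N)%N then (sys_sub k.+1)^T *m cvblk y k.+1 else 0) = sys_rhs k).
Proof.
apply: iff_trans (iff_sym (cvblkP _ _)) _; split=> eqs k kN.
  by rewrite -cvblk_sysmx_mul // eqs // cvblk_sysrhs.
by rewrite cvblk_sysmx_mul // cvblk_sysrhs // eqs.
Qed.

Lemma sysmx_minP (y : 'cV[K]_(\sum_(i < N) n)) :
  sysmx N Q G R H *m y = sysrhs N Q G R H z g0 <->
  (forall y',
     objective (N := N) Q G R H z g0 y <= objective (N := N) Q G R H z g0 y').
Proof.
have pdQ : sym_posdef (invmx (stackQ N Q)).
  by apply/sym_posdef_inv/sym_posdef_mxdiag => i; apply: (@Qpd i.+1 (ltn_ord i)).
have pdR : sym_posdef (invmx (stackR N R)).
  by apply/sym_posdef_inv/sym_posdef_mxdiag => i; apply: (@Rpd i.+1 (ltn_ord i)).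
(* The constant term, which is the value of the objective at 0. *)
pose f0 := 2^-1 * ((stackz N z)^T *m invmx (stackR N R) *m stackz N z) 0 0
  + 2^-1 * ((stackw N g0)^T *m invmx (stackQ N Q) *m stackw N g0) 0 0.
apply: (sym_psd_quad_min (f0 := f0)).
  by apply: sym_psdD; apply/sym_psd_congr/sym_posdef_psd.
move=> v; rewrite /objective !weighted_residualE ?pdQ.1 ?pdR.1 //.
rewrite /sysmx /sysrhs mulmxDr [v^T *m (_ + _)]mulmxDr mulmxDl !mx00D.
by rewrite /f0; ring.
Qed.

End StackedSystem.

(** * Identification of the algorithm with the filter and the smoother *)

Section KalmanBlockTridiagonal.
Context (K : realType) (N n : nat) (m : nat -> nat).
Context (Q G : nat -> 'M[K]_n) (R : forall k, 'M[K]_(m k)).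
Context (H : forall k, 'M[K]_(m k, n)) (z : forall k, 'cV[K]_(m k)).
Context (g0 : 'cV[K]_n).
Hypothesis Qpd : forall k, (1 <= k <= N)%N -> sym_posdef (Q k).
Hypothesis Rpd : forall k, (1 <= k <= N)%N -> sym_posdef (R k).

Local Notation Ppred := (kf_Ppred Q G R H).
Local Notation P := (kf_P Q G R H).
Local Notation x := (kf_x Q G R H z g0).

Lemma kf_updP_posdef (k : nat) (P0 : 'M[K]_n) : (1 <= k <= N)%N ->
  sym_posdef P0 -> sym_posdef (kf_updP R H k P0).
Proof.
move=> kN pdP0; apply/sym_posdef_inv/sym_posdefD; first exact: sym_posdef_inv.
exact/sym_psd_congr/sym_posdef_psd/sym_posdef_inv/Rpd.
Qed.

(** Definiteness comes from [Q k]; the propagated term G P G^T is only semidefinite when G is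
    singular. *)
Lemma kf_Ppred_posdef (k : nat) : (1 <= k <= N)%N -> sym_posdef (Ppred k).
Proof.
elim: k => [//|[|k] IHk] kN; first exact: Qpd.
rewrite kf_PpredS // addrC; apply: sym_posdefD; first exact: Qpd.
rewrite -[X in X *m _ *m _]trmxK; apply/sym_psd_congr/sym_posdef_psd.
by have kN' := ltnW kN; apply: kf_updP_posdef => //; apply: IHk.
Qed.

Lemma kf_P_posdef (k : nat) : (1 <= k <= N)%N -> sym_posdef (P k).
Proof. by move=> kN; apply: kf_updP_posdef => //; apply: kf_Ppred_posdef. Qed.

Variables (c a : nat -> 'M[K]_n) (r : nat -> 'cV[K]_n).
Hypothesis cE : forall k, (1 <= k <= N)%N -> c k = sys_diag N Q G R H k.
Hypothesis aE : forall k, (2 <= k <= N)%N -> a k = sys_sub Q G k.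
Hypothesis rE : forall k, (1 <= k <= N)%N -> r k = sys_rhs Q R H z g0 k.

(** The information that the transition to time k+1 adds to pivot k. Its value 0 at k = N gives both
    clauses on d_k a single form. *)
Definition info_next (k : nat) : 'M[K]_n :=
  if (k < N)%N then (G k.+1)^T *m invmx (Q k.+1) *m G k.+1 else 0.

Lemma info_posdef (k : nat) : (1 <= k <= N)%N ->
  sym_posdef (invmx (P k) + info_next k).
Proof.
move=> kN; apply: sym_posdefD; first exact/sym_posdef_inv/kf_P_posdef.
rewrite /info_next; case: ifP => kN'.
  exact/sym_psd_congr/sym_posdef_psd/sym_posdef_inv/Qpd.
by split=> [|v]; rewrite ?trmx0 // mulmx0 mul0mx mxE.
Qed.

(** Supplies the invertibility hypotheses of the gain identities at step k. *)
Lemma step_unitmx (k : nat) : (1 <= k < N)%N ->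
  [/\ P k \in unitmx, Q k.+1 \in unitmx,
      G k.+1 *m P k *m (G k.+1)^T + Q k.+1 \in unitmx
    & invmx (P k) + (G k.+1)^T *m invmx (Q k.+1) *m G k.+1 \in unitmx].
Proof.
move=> /andP[k0 kN]; have kN' : (1 <= k <= N)%N by rewrite k0 ltnW.
split; first exact/sym_posdef_unit/kf_P_posdef.
- exact/sym_posdef_unit/Qpd.
- by rewrite -kf_PpredS //; apply/sym_posdef_unit/kf_Ppred_posdef.
- by have := sym_posdef_unit (info_posdef kN'); rewrite /info_next kN.
Qed.

Lemma invmx_kf_P (k : nat) :
  invmx (P k) = invmx (Ppred k) + (H k)^T *m invmx (R k) *m H k.
Proof. by rewrite kf_PE invmxK. Qed.

Lemma invmx_kf_P_mulx (k : nat) : (1 <= k <= N)%N ->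
  invmx (P k) *m x k =
  invmx (Ppred k) *m kf_xpred Q G R H z g0 k + (H k)^T *m invmx (R k) *m z k.
Proof.
by move=> kN; rewrite kf_xE mulKmx //; apply/sym_posdef_unit/kf_P_posdef.
Qed.

Lemma bt_dE (k : nat) : (1 <= k <= N)%N ->
  bt_d c a k = invmx (P k) + info_next k.
Proof.
elim: k => [//|[|k] IHk] kN.
  by rewrite bt_d1 cE // invmx_kf_P /sys_diag addrAC.
have kN' : (1 <= k.+1 < N)%N by exact: kN.
have [uP uQ uS uD] := step_unitmx kN'.
rewrite bt_dS // IHk ?(ltnW kN) // cE // aE // sys_sub_tr; last exact: Qpd.
rewrite (invmx_kf_P k.+2) (kf_PpredS Q G R H (ltn0Sn k)).
(* Applied from right to left: the inverse predicted covariance splits into the Q^-1 of c_{k+1} and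
   the elimination term. *)
rewrite -invmx_innovationE // /info_next (kN : (k.+1 < N)%N) /sys_sub.
rewrite mulNmx mulNmx mulmxN opprK /sys_diag !mulmxA.
by rewrite -!addrA; congr (_ + _); rewrite [RHS]addrC -addrA [RHS]addrCA.
Qed.

Lemma bt_sE (k : nat) : (1 <= k <= N)%N -> bt_s c a r k = invmx (P k) *m x k.
Proof.
elim: k => [//|[|k] IHk] kN.
  by rewrite bt_s1 rE // invmx_kf_P_mulx.
have kN' : (1 <= k.+1 < N)%N by exact: kN.
have [uP uQ uS uD] := step_unitmx kN'.
rewrite bt_sS // IHk ?(ltnW kN) // bt_dE ?(ltnW kN) // rE // aE //.
rewrite (invmx_kf_P_mulx kN) (kf_PpredS Q G R H (ltn0Sn k)).
rewrite kf_xpredS // /info_next (kN : (k.+1 < N)%N) /sys_sub mulNmx mulNmx opprK.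
(* After time 1 the right-hand side has no [g0] term. The elimination term becomes S^-1 G P P^-1 x,
   that is, S^-1 applied to the predicted state. *)
rewrite info_gainE // /sys_rhs add0r addrC !mulmxA; congr (_ *m _ + _).
by rewrite mulmxK.
Qed.

Lemma bt_eE (k : nat) : (1 <= k <= N)%N ->
  bt_e N c a r k = rts_x N Q G R H z g0 k.
Proof.
move=> /andP[k0 kN]; have [j Ej] : exists j, j = (N - k)%N by eexists.
elim: j k k0 kN Ej => [|j IHj] k k0 kN Ej.
  have kE : k = N by apply/eqP; rewrite eqn_leq kN /= -subn_eq0 -Ej.
  have N0 : (1 <= N <= N)%N by rewrite -{1}kE k0 /=.
  rewrite kE bt_eN rts_xN bt_dE // bt_sE // /info_next ltnn addr0.
  by rewrite mulKmx // unitmx_inv; apply/sym_posdef_unit/kf_P_posdef.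
have kN' : (1 <= k < N)%N by rewrite k0 -subn_gt0 -Ej.
have [_ kN1] := andP kN'; have [uP uQ uS uD] := step_unitmx kN'.
rewrite bt_eS // rts_xS // (IHj k.+1) // ?subnS -?Ej //.
rewrite bt_dE ?bt_sE ?k0 // aE // sys_sub_tr; last exact: Qpd.
rewrite /info_next kN1 mulNmx opprK kf_xpredS //.
move: (x k) (rts_x _ _ _ _ _ _ _ _) => xk e.
(* With the RTS gain L = P G^T S^-1, the two parts are x - L G x and L e, which add up to x + L (e -
   G x). *)
rewrite mulmxDr !mulmxA smoother_gainE // cov_gainE // -kf_PpredS //.
by rewrite mulmxBl mul1mx mulmxBr !mulmxA addrAC -addrA.
Qed.

End KalmanBlockTridiagonal.

(** * Equivalence for the blocks extracted from the stacked system *)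

Theorem mainTheorem1 (K : realType) (N n : nat) (m : nat -> nat)
    (Q G : nat -> 'M[K]_n) (R : forall k, 'M[K]_(m k))
    (H : forall k, 'M[K]_(m k, n)) (z : forall k, 'cV[K]_(m k))
    (g0 : 'cV[K]_n)
    (N_gt0 : (0 < N)%N)
    (Qpd : forall k, (1 <= k <= N)%N -> sym_posdef (Q k))
    (Rpd : forall k, (1 <= k <= N)%N -> sym_posdef (R k)) :
  let A := sysmx N Q G R H in
  let b := sysrhs N Q G R H z g0 in
  let J := objective Q G R H z g0 in
  let c k := mxblk A k k in
  let a k := mxblk A k k.-1 in
  let r k := cvblk b k in
  let d := bt_d c a in
  let s := bt_s c a r in
  let e := bt_e N c a r in
  let Ppred := kf_Ppred Q G R H in
  let P := kf_P Q G R H in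
  let x := kf_x Q G R H z g0 in
  let xN := rts_x N Q G R H z g0 in
  (* the system characterizes the minimizer of the objective *)
  (forall y, A *m y = b <-> (forall y', J y <= J y')) /\
  (* the system matrix is block tridiagonal, with the explicit blocks *)
  (forall k l, (1 <= k <= N)%N -> (1 <= l <= N)%N ->
     (k.+1 < l)%N || (l.+1 < k)%N -> mxblk A k l = 0) /\
  (forall k, (2 <= k <= N)%N ->
     a k = - (invmx (Q k) *m G k) /\ mxblk A k.-1 k = (a k)^T) /\
  (forall k, (1 <= k <= N)%N ->
     c k = invmx (Q k)
           + (if (k < N)%N then (G k.+1)^T *m invmx (Q k.+1) *m G k.+1 else 0)
           + (H k)^T *m invmx (R k) *m H k) /\
  (* every matrix inverted along the way is invertible *)
  (forall k, (1 <= k <= N)%N ->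
     [/\ d k \in unitmx, Ppred k \in unitmx & P k \in unitmx]) /\
  (* the algorithm outputs the solution of the system *)
  (forall y, A *m y = b <-> y = \mxcol_(i < N) e i.+1) /\
  (* the equivalence with the Kalman filter and the RTS smoother *)
  [/\ (forall k, (1 <= k < N)%N ->
         d k = invmx (P k) + (G k.+1)^T *m invmx (Q k.+1) *m G k.+1)
      /\ d N = invmx (P N),
      (forall k, (1 <= k <= N)%N -> s k = invmx (P k) *m x k),
      e N = x N
    & (forall k, (1 <= k <= N)%N -> e k = xN k)].
Proof.
move=> A b J c a r d s e Ppred P x xN.
have cE k : (1 <= k <= N)%N -> c k = sys_diag N Q G R H k.
  by move=> kN; rewrite /c mxblk_sysmx // ltn_eqF // eqxx.
(* The range starts at 2: truncated predecessors make [mxblk A 1 0] the first diagonal block. *)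
have aE k : (2 <= k <= N)%N -> a k = sys_sub Q G k.
  case: k => [//|k] /andP[k1 kN]; rewrite /a mxblk_sysmx //=; last first.
    by rewrite -ltnS k1 ltnW.
  by rewrite eqxx.
have rE k : (1 <= k <= N)%N -> r k = sys_rhs Q R H z g0 k.
  by move=> kN; rewrite /r cvblk_sysrhs.
have dE := bt_dE Qpd Rpd cE aE; have sE := bt_sE Qpd Rpd cE aE rE.
have eE := bt_eE Qpd Rpd cE aE rE.
have ud k : (1 <= k <= N)%N -> d k \in unitmx.
  by move=> kN; rewrite /d dE //; apply/sym_posdef_unit/info_posdef.
have NN : (1 <= N <= N)%N by rewrite N_gt0 /=.
split; first exact: sysmx_minP.
split.
  move=> k l kN lN /orP[kl|lk]; rewrite mxblk_sysmx //.
    have kl' := ltnW kl.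
    by rewrite (ltn_eqF (leqW kl')) (ltn_eqF kl') (ltn_eqF kl).
  have lk' := ltnW lk.
  by rewrite (gtn_eqF lk) (gtn_eqF lk') (gtn_eqF (leqW lk')).
split.
  move=> k kN; rewrite aE //; split=> //.
  case: k kN => [//|k] /andP[k1 kN]; rewrite mxblk_sysmx //=; last first.
    by rewrite -ltnS k1 ltnW.
  by rewrite (ltn_eqF (leqW (leqnn _))) (ltn_eqF (leqnn _)) eqxx.
split; first by [].
split.
  move=> k kN; split; first exact: ud.
    exact: sym_posdef_unit (kf_Ppred_posdef _ _ Qpd Rpd kN).
  exact: sym_posdef_unit (kf_P_posdef _ _ Qpd Rpd kN).
split.
  move=> y; apply: iff_trans (sysmx_solveP G H z g0 Qpd Rpd y) _.
  (* The guards keep every block index in range, so the explicit blocks may be exchanged for those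
     of [A], as [bt_solveP] requires. *)
  have rowE k : (1 <= k <= N)%N ->
      (if (1 < k)%N then sys_sub Q G k *m cvblk y k.-1 else 0)
      + sys_diag N Q G R H k *m cvblk y k
      + (if (k < N)%N then (sys_sub Q G k.+1)^T *m cvblk y k.+1 else 0)
      = (if (1 < k)%N then a k *m cvblk y k.-1 else 0) + c k *m cvblk y k
      + (if (k < N)%N then (a k.+1)^T *m cvblk y k.+1 else 0).
    move=> /andP[k0 kN]; rewrite cE ?k0 //; congr (_ + _ + _).
      by case: ifP => // k1; rewrite aE // k1.
    by case: ifP => // kN'; rewrite aE // ltnS k0.
  apply: (@iff_trans _ (forall k, (1 <= k <= N)%N -> cvblk y k = e k)).
    apply: iff_trans _ (bt_solveP r (cvblk y) ud); split=> eqs k kN.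
      by rewrite -rowE // eqs // rE.
    by rewrite rowE // eqs // rE.
  split=> [eqs|-> k kN]; last by rewrite cvblk_mxcol.
  by rewrite [LHS]mxcol_cvblk; apply: eq_mxcol => i; exact: (eqs i.+1 (ltn_ord i)).
split=> //.
- split=> [k /andP[k0 kN]|].
    by rewrite /d dE ?k0 ?(ltnW kN) // /info_next kN.
  by rewrite /d dE // /info_next ltnn addr0.
- by rewrite /e eE // /xN rts_xN.
Qed.
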